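(* There is a function $q\colon \mathbb{N}\times\mathbb{N} \to \mathbb{N}$ such that, for every $c,d,k\in \mathbb{N}$, the following hold, where all graphs may be infinite. (i) Every graph that has a $(k,d)$-centred line-decomposition is $q(k,d)$-quasi-isometric to a graph with linewidth at most $2k-1$. (ii) Every graph that is $c$-quasi-isometric to a graph with linewidth at most $k$ has a $(k+1,3c^2)$-centred line-decomposition.
   Context: $\mathbb{N}$ is the set of positive integers. Graphs are simple, undirected and unweighted, and may be infinite and disconnected. $\operatorname{dist}_G(u,v)$ is the length of a shortest path between $u$ and $v$ in $G$, and is $\infty$ if no such path exists. Quasi-isometry: for $q\in\mathbb{N}$, a $q$-quasi-isometry of $G$ into $H$ is a map $\phi\colon V(G)\to V(H)$ such that $q^{-1}\operatorname{dist}_G(u,v)-q\le \operatorname{dist}_H(\phi(u),\phi(v))\le q\operatorname{dist}_G(u,v)+q$ for all $u,v\in V(G)$, and for every $x\in V(H)$ there is $v\in V(G)$ with $\operatorname{dist}_H(x,\phi(v))\le q$. If such a map exists, $G$ is $q$-quasi-isometric to $H$. Line-decompositions: a line is a linearly ordered set $(L,<)$. For a line $L$, an $L$-decomposition of a graph $G$ is a pair $(L,\beta)$ with $\beta\colon L\to 2^{V(G)}$ such that for every edge $uv\in E(G)$ some $x\in L$ has $u,v\in\beta(x)$, and for every $v\in V(G)$ the set $\{x\in L: v\in\beta(x)\}$ is a non-empty interval of $L$ (that is, if $x<y<z$ and $v\in\beta(x)\cap\beta(z)$, then $v\in\beta(y)$). The sets $\beta(x)$ are the bags. The width of $(L,\beta)$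 is $\max_{x\in L}|\beta(x)|-1$. A line-decomposition is an $L$-decomposition for some line $L$. The linewidth of $G$ is the minimum integer $k$ such that $G$ has an $L$-decomposition of width at most $k$ for some line $L$, and is infinite if there is none. Centred sets: the weak diameter of $X\subseteq V(G)$ is the maximum of $\operatorname{dist}_G(u,v)$ over $u,v\in X$ (distances measured in $G$). A set $S\subseteq V(G)$ is $(k,d)$-centred if $S$ has a partition into at most $k$ sets, each of weak diameter at most $d$. A line-decomposition of $G$ is $(k,d)$-centred if each of its bags is $(k,d)$-centred. *)

(* Defs.v *)
From HB Require Import structures.
From mathcomp Require Import all_boot all_order all_algebra.
From mathcomp Require Import boolp classical_sets functions cardinality.
From mathcomp Require Import constructive_ereal.

Set Implicit Arguments.
Unset Strict Implicit.
Unset Printing Implicit Defensive.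

Import Order.TTheory GRing.Theory Num.Theory.
Local Open Scope classical_set_scope.
Local Open Scope card_scope.
Local Open Scope ring_scope.
Local Open Scope ereal_scope.

Record graph := Graph {
  vertex :> Type;
  adj : vertex -> vertex -> Prop;
  adj_sym : forall u v, adj u v -> adj v u;
  adj_irrefl : forall u, ~ adj u u
}.

(* The least natural number satisfying P, and +oo if there is none; rat is
   only the ambient field in which the inequalities below are written. *)
Definition least (P : nat -> Prop) : \bar rat :=
  if pselect (exists n, `[< P n >]) is left ex then (ex_minn ex)%:R%:E
  else +oo.

Definition is_path (G : graph) (u v : G) (n : nat) : Prop :=
  exists p : nat -> G,
    [/\ p 0%N = u,
        p n = v,
        forall i j, (i <= n)%N -> (j <= n)%N -> p i = p j -> i = j &
        forall i, (i < n)%N -> adj (p i) (p i.+1)].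

Definition dist (G : graph) (u v : G) : \bar rat := least (is_path u v).

Definition quasi_isometry (q : nat) (G H : graph) (phi : G -> H) : Prop :=
  (forall u v : G,
     ((q%:R)^-1)%:E * dist u v - q%:R%:E <= dist (phi u) (phi v) /\
     dist (phi u) (phi v) <= q%:R%:E * dist u v + q%:R%:E) /\
  (forall x : H, exists v : G, dist x (phi v) <= q%:R%:E).

Definition quasi_isometric (q : nat) (G H : graph) : Prop :=
  exists phi : G -> H, quasi_isometry q phi.

Definition line_decomposition (G : graph) (disp : Order.disp_t)
    (L : orderType disp) (beta : L -> set G) : Prop :=
  [/\ forall u v : G, adj u v -> exists x, beta x u /\ beta x v,
      forall v : G, exists x, beta x v &
      forall (v : G) (x y z : L),
        (x < y)%O -> (y < z)%O -> beta x v -> beta z v -> beta y v].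

(* The maximum of the bag sizes is the least common upper bound in nat. The
   empty line, which only decomposes the empty graph, gets width -1. *)
Definition width (G : graph) (disp : Order.disp_t) (L : orderType disp)
    (beta : L -> set G) : \bar rat :=
  least (fun n => forall x, beta x #<= `I_n) - 1.

(* Every width is at least -1, so the minimum is over the integers n - 1 with
   n in nat. *)
Definition linewidth (G : graph) : \bar rat :=
  least (fun n => exists (disp : Order.disp_t) (L : orderType disp)
                         (beta : L -> set G),
           line_decomposition beta /\ width beta <= n%:R%:E - 1) - 1.

(* As for width, the maximum is the least upper bound in nat. *)
Definition weak_diameter (G : graph) (X : set G) : \bar rat :=
  least (fun d => forall u v, X u -> X v -> dist u v <= d%:R%:E).

Definition centred (k d : nat) (G : graph) (S : set G) : Prop :=
  exists P : set (set G),
    [/\ partition P id S,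
        P #<= `I_k &
        forall X, P X -> weak_diameter X <= d%:R%:E].

Definition has_centred_line_decomposition (k d : nat) (G : graph) : Prop :=
  exists (disp : Order.disp_t) (L : orderType disp) (beta : L -> set G),
    line_decomposition beta /\ forall x, centred k d (beta x).

(* Main.v *)
Require Import Defs.
From mathcomp Require Import all_boot all_order all_algebra.
From mathcomp Require Import constructive_ereal.
From mathcomp Require Import boolp classical_sets functions cardinality filter.
From mathcomp Require Import zify.

(* (i) Relate vertices of a common bag that are at distance at most d: distances
   change by a factor of at most d, and each bag becomes a union of k cliques.
   It suffices to 2-colour the vertices so that monochromatic components have
   bounded weak diameter: contract them, and note that a clique meets at most
   two, so every bag meets at most 2k. By compactness it is enough to colour
   finite connected sets. There, a geodesic from a first to a last vertex of
   the line meets every bag, so removing its closed neighbourhood N costs each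
   bag one clique and induction on k colours the rest with components of
   diameter at most D. Colour N by cutting the geodesic into segments of length
   D + 4 of alternating colours.
   (ii) Pull back the c-balls around the vertices of each bag: the midpoint of
   a walk of length at most 2c shows that edges are covered. *)

Set Implicit Arguments.
Unset Strict Implicit.
Unset Printing Implicit Defensive.

Import Order.TTheory GRing.Theory Num.Theory.

(** * Walks *)

Section Walks.
Variables (V : Type) (R : V -> V -> Prop).

(** Vertices may repeat, so walks concatenate and map freely; [dist_leP] shows that they measure the
    same distances as paths. *)
Fixpoint walk n u v : Prop :=
  if n is n'.+1 then exists2 w, R u w & walk n' w v else u = v.

Definition linked u v := exists n, walk n u v.

Lemma walk_cat m n u v w : walk m u v -> walk n v w -> walk (m + n) u w.
Proof.
elim: m u => [|m IH] u /=; first by move=> ->.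
by case=> x ux /IH xv /xv xw; exists x.
Qed.

Lemma walk_split m n u w :
  walk (m + n) u w -> exists2 v, walk m u v & walk n v w.
Proof.
elim: m u => [|m IH] u /=; first by exists u.
by case=> x ux /IH[v xv vw]; exists v => //; exists x.
Qed.

Lemma walk1 u v : R u v -> walk 1 u v.
Proof. by exists v. Qed.

Lemma walkP n u v : walk n u v <->
  exists p : nat -> V,
    [/\ p 0 = u, p n = v & forall i, i < n -> R (p i) (p i.+1)].
Proof.
split.
  elim: n u => [|n IH] u /=; first by move=> ->; exists (fun=> v).
  case=> w uw /IH[p [p0 pn pR]].
  exists (fun i => if i is j.+1 then p j else u); split=> // -[_|i /pR//].
  by rewrite p0.
elim: n u v => [|n IH] u v [p [<- <- pR]] //=.
exists (p 1); first exact: pR.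
by apply: IH; exists (fun i => p i.+1); split=> // i ilt; apply: pR.
Qed.

Lemma walk_fun p i j : i <= j ->
  (forall l, l < j -> R (p l) (p l.+1)) -> walk (j - i) (p i) (p j).
Proof.
move=> ij pR; apply/walkP; exists (fun l => p (l + i)); split.
- by rewrite add0n.
- by rewrite subnK.
- by move=> l ll; rewrite addSn; apply: pR; lia.
Qed.

Lemma linked_refl u : linked u u.
Proof. by exists 0. Qed.

Lemma linked_trans v u w : linked u v -> linked v w -> linked u w.
Proof. by move=> [m uv] [n vw]; exists (m + n); apply: walk_cat uv vw. Qed.

Lemma shortest_walk u v : linked u v ->
  exists2 n, walk n u v & forall m, walk m u v -> n <= m.
Proof.
move=> [n0 w0].
have ex : exists n, `[< walk n u v >] by exists n0; apply/asboolP.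
exists (ex_minn ex); case: ex_minnP => n /asboolP nw nmin // m mw.
by apply: nmin; apply/asboolP.
Qed.

(** Otherwise, replacing the stretch from [p i] to [p j] by the given walk would shorten a shortest
    walk. *)
Lemma geodesic n p :
  (forall i, i < n -> R (p i) (p i.+1)) ->
  (forall m, walk m (p 0) (p n) -> n <= m) ->
  forall i j m, i <= n -> j <= n -> walk m (p i) (p j) -> j <= i + m.
Proof.
move=> pR nmin i j m iN jN wm.
have w0 : walk i (p 0) (p i).
  by rewrite -{1}[i]subn0; apply: walk_fun => // l ll; apply: pR; lia.
have w1 : walk (n - j) (p j) (p n) by apply: walk_fun.
have := nmin _ (walk_cat (walk_cat w0 wm) w1); lia.
Qed.

Hypothesis Rsym : forall u v, R u v -> R v u.

Lemma walk_sym n u v : walk n u v -> walk n v u.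
Proof.
elim: n u => [|n IH] u /=; first by move=> ->.
case=> w /Rsym wu /IH vw.
by have := walk_cat vw (walk1 wu); rewrite addn1.
Qed.

Lemma linked_sym u v : linked u v -> linked v u.
Proof. by case=> n /walk_sym; exists n. Qed.

End Walks.

Lemma walk_map (V W : Type) (R : V -> V -> Prop) (S : W -> W -> Prop)
    (h : V -> W) n u v :
  (forall a b, R a b -> S (h a) (h b)) -> walk R n u v -> walk S n (h u) (h v).
Proof.
move=> RS; elim: n u => [|n IH] u /=; first by move=> ->.
by case=> w /RS uw /IH wv; exists (h w).
Qed.

Lemma walk_sub (V : Type) (R S : V -> V -> Prop) n u v :
  (forall a b, R a b -> S a b) -> walk R n u v -> walk S n u v.
Proof. exact: (@walk_map _ _ R S id). Qed.

Lemma walk_stretch (V W : Type) (R : V -> V -> Prop) (S : W -> W -> Prop)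
    (h : V -> W) d n u v :
  (forall a b, R a b -> exists2 m, m <= d & walk S m (h a) (h b)) ->
  walk R n u v -> exists2 m, m <= d * n & walk S m (h u) (h v).
Proof.
move=> RS; elim: n u => [|n IH] u /=; first by move=> ->; exists 0.
case=> w /RS[m md uw] /IH[m' md' wv]; exists (m + m'); first by nia.
exact: walk_cat uw wv.
Qed.

(** * Bags along a line *)

Section Decomposition.
Variables (V : Type) (disp : Order.disp_t) (L : orderType disp).
Variable (beta : L -> set V).

Definition convex_bags := forall v x y z, (x < y)%O -> (y < z)%O ->
  beta x v -> beta z v -> beta y v.

Definition shares_bag u v := exists x, beta x u /\ beta x v.

Lemma convex_bagsW (cb : convex_bags) v x y z : (x <= y)%O -> (y <= z)%O ->
  beta x v -> beta z v -> beta y v.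
Proof.
move=> xy yz xv zv.
have [<-//|nxy] := eqVneq x y; have [->//|nyz] := eqVneq y z.
by apply: (cb v x y z) => //; rewrite lt_neqAle ?nxy ?nyz.
Qed.

(** Let [t] index a bag shared by [p 0] and [p 1]. If [y <= t], convexity puts [p 0] in [beta y];
    otherwise induct from [p 1] and [t]. *)
Lemma walk_meets_bag (cb : convex_bags) n p x y z :
  (forall i, i < n -> shares_bag (p i) (p i.+1)) ->
  (x <= y)%O -> (y <= z)%O -> beta x (p 0) -> beta z (p n) ->
  exists2 i, i <= n & beta y (p i).
Proof.
elim: n p x => [|n IH] p x sh xy yz bx bz.
  by exists 0 => //; apply: convex_bagsW xy yz bx bz.
have [t [t0 t1]] := sh 0 isT.
case: (leP y t) => [yt|/ltW ty].
  by exists 0 => //; apply: convex_bagsW xy yt bx t0.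
have [|i iN bi] := IH (fun i => p i.+1) t _ ty yz t1 bz.
  by move=> i ilt; apply: sh.
by exists i.+1.
Qed.

(** Compares the left ends of two intervals without assuming that these ends exist as points of
    [L]. *)
Definition starts_before u v :=
  forall y, beta y v -> exists2 x, (x <= y)%O & beta x u.

Lemma starts_before_total u v : starts_before u v \/ starts_before v u.
Proof.
have [|/existsNP[y /not_implyP[yv ny]]] := pselect (starts_before u v).
  by left.
right=> x xu; exists y => //; rewrite leNgt; apply/negP => xy.
by apply: ny; exists x => //; apply: ltW.
Qed.

Lemma starts_before_trans v u w :
  starts_before u v -> starts_before v w -> starts_before u w.
Proof.
move=> uv vw y /vw[x xy /uv[t tx tu]]; exists t => //; exact: le_trans xy.
Qed.

End Decomposition.

(** * Minima over finite sets *)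

Definition listed (V : Type) (s : seq V) : set V := fun v => List.In v s.

Lemma seq_minimum (V : Type) (le : V -> V -> Prop) (A : set V) (s : seq V) :
  (forall u v, le u v \/ le v u) ->
  (forall v u w, le u v -> le v w -> le u w) ->
  (A `<=` listed s)%classic -> (exists v, A v) ->
  exists2 u, A u & forall v, A v -> le u v.
Proof.
move=> tot tr; elim: s A => [|a s IH] A As [v0 Av0]; first by case: (As _ Av0).
have lexx u : le u u by case: (tot u u).
have [[v [Av nva]]|none] := pselect (exists v, A v /\ v <> a); last first.
  have all_a v : A v -> v = a.
    by move=> Av; apply: contrapT => nva; apply: none; exists v.
  by exists v0 => // v /all_a->; rewrite (all_a _ Av0).
have [||u [Au nua] umin] := IH (fun v => A v /\ v <> a).
- by move=> w [/As[->|]].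
- by exists v.
have [Aa|nAa] := pselect (A a); last first.
  by exists u => // w Aw; apply: umin; split=> // wa; apply: nAa; rewrite -wa.
have [ua|au] := tot u a.
  exists u => // w Aw; have [->//|nwa] := pselect (w = a).
  exact: umin.
exists a => // w Aw; have [->//|nwa] := pselect (w = a).
by apply: tr au _; apply: umin.
Qed.

(** * Two-colourings with bounded monochromatic components *)

(** Distinct quotients of equal parity differ by at least 2, which puts [a] and [b] more than [M]
    apart. *)
Lemma eq_divn_odd a b M : odd (a %/ M) = odd (b %/ M) ->
  a <= b + M -> b <= a + M -> a %/ M = b %/ M.
Proof.
have [->|M0] := posnP M; first by rewrite !divn0.
wlog lt : a b / a %/ M < b %/ M => [hw|] odd_eq ab ba.
  have [lt|lt|//] := ltngtP (a %/ M) (b %/ M); first exact: hw.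
  by apply/esym; apply: hw.
have [e|le] : b %/ M = (a %/ M).+1 \/ (a %/ M).+2 <= b %/ M by lia.
  by move: odd_eq; rewrite e /=; case: odd.
have := leq_mul le (leqnn M); rewrite !mulSn.
have := divn_eq a M; have := divn_eq b M; have := ltn_pmod a M0; lia.
Qed.

Definition induced (V : Type) (A : set V) (R : V -> V -> Prop) u v :=
  [/\ A u, A v & R u v].

Definition same_colour (V : Type) (c : V -> bool) (R : V -> V -> Prop) u v :=
  R u v /\ c u = c v.

(** The cliques are the fibres of a labelling, so that dropping one clique amounts to
    relabelling. *)
Definition clique_cover (V : Type) (R : V -> V -> Prop) k (S : set V) :=
  exists f : V -> nat, (forall v, S v -> f v < k) /\
    (forall u v, S u -> S v -> f u = f v -> u = v \/ R u v).

(** The joining walk may leave the colour class: this bounds the weak diameter of monochromatic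
    components, measured in [R]. *)
Definition good_colouring (V : Type) (R : V -> V -> Prop) D (c : V -> bool) :=
  forall u v, linked (same_colour c R) u v ->
    exists2 m, m <= D & walk R m u v.

(** With [D] the previous value, [3 * D + 8] adds up a route between two vertices: at most [D + 1]
    from each to the neighbourhood of the geodesic, one more step from each onto it, and [D + 4]
    along it. For [k = 0] there are no vertices to colour. *)
Fixpoint colour_diam k := if k is k'.+1 then 3 * colour_diam k' + 8 else 0.

Lemma walk_support (V : Type) (R : V -> V -> Prop) n u v :
  walk R n u v -> exists s, walk (induced (listed s) R) n u v.
Proof.
elim: n u => [|n IH] u /=; first by move=> ->; exists [::].
case=> w uw /IH[s wv]; exists (u :: w :: s) => /=.
exists w; first by split=> //; [left|right; left].
by apply: walk_sub wv => a b [sa sb ab]; split=> //; do 2 right.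
Qed.

Section Colouring.
Variables (V : Type) (R : V -> V -> Prop).
Hypothesis Rsym : forall u v, R u v -> R v u.
Variables (disp : Order.disp_t) (L : orderType disp) (beta : L -> set V).
Hypothesis cb : convex_bags beta.
Hypothesis edge_bag : forall u v, R u v -> shares_bag beta u v.
Hypothesis vertex_bag : forall v, exists x, beta x v.

Lemma induced_sym A u v : induced A R u v -> induced A R v u.
Proof. by case=> Au Av /Rsym. Qed.

Lemma same_colour_sym A c u v :
  same_colour c (induced A R) u v -> same_colour c (induced A R) v u.
Proof. by case=> /induced_sym vu cuv; split. Qed.

(** * Induction step for a finite connected set *)

Section Connected.
Variables (A : set V) (s : seq V) (k : nat).
Hypothesis As : (A `<=` listed s)%classic.
Hypothesis Aconn : forall u v, A u -> A v -> linked (induced A R) u v.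
Hypothesis Acover : forall x, clique_cover R k.+1 (beta x `&` A)%classic.
Hypothesis IH : forall B : set V, (B `<=` A)%classic ->
  (forall x, clique_cover R k (beta x `&` B)%classic) ->
  exists c, good_colouring (induced B R) (colour_diam k) c.

(* Endpoints that start first and end last: any walk between them then meets
   every bag of [A]. *)
Lemma spanning_geodesic : (exists v, A v) ->
  exists n (p : nat -> V),
    [/\ forall i, i <= n -> A (p i),
        forall i, i < n -> induced A R (p i) (p i.+1),
        forall m, walk (induced A R) m (p 0) (p n) -> n <= m &
        forall x v, A v -> beta x v -> exists2 i, i <= n & beta x (p i)].
Proof.
move=> Ane.
have [u Au umin] := seq_minimum (starts_before_total beta)
  (@starts_before_trans _ _ _ beta) As Ane.
(* Over the dual order [starts_before] compares right ends, so [w] ends last. *)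
pose L' := L^d%type.
have [w Aw wmin] := seq_minimum (@starts_before_total _ _ L' beta)
  (@starts_before_trans _ _ L' beta) As Ane.
have [n /walkP[p [p0 pn pR]] nmin] := shortest_walk (Aconn Au Aw).
exists n, p; split=> //.
- by case=> [|i] ilt; [rewrite p0|case: (pR i ilt)].
- by rewrite p0 pn.
move=> x v Av xv.
have [x1 x1x x1u] := umin v Av x xv.
have [x2 xx2 x2w] := wmin v Av x xv.
apply: (@walk_meets_bag _ _ _ beta cb n p x1 x x2) => //.
- by move=> i /pR[_ _ /edge_bag].
- by rewrite p0.
- by rewrite pn.
Qed.

Lemma connected_colouring :
  exists c, good_colouring (induced A R) (colour_diam k.+1) c.
Proof.
have [Ane|Aempty] := pselect (exists v, A v); last first.
  exists (fun=> true) => u v [[|n] /=]; first by move=> ->; exists 0.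
  by case=> w [[Au]]; case: Aempty; exists u.
have [n [p [pA pR nmin pbag]]] := spanning_geodesic Ane.
pose near v i := i <= n /\ (v = p i \/ R v (p i)).
pose N v := A v /\ exists i, near v i.
pose Y : set V := fun v => A v /\ ~ N v.
have YA : (Y `<=` A)%classic by move=> v [].
have NY v : A v -> ~ N v -> Y v by [].
(* Off [N] each bag loses the clique of its vertex on the geodesic. *)
have [|c' c'good] := IH YA.
  move=> x; have [f [fk fR]] := Acover x.
  have [[v [xv Av]]|none] := pselect (exists v, beta x v /\ A v); last first.
    by exists (fun=> 0); split=> [v [xv [Av _]]|u v [xv [Av _]]];
      case: none; [exists v|exists u].
  have [i iN xi] := pbag x v Av xv.
  have fne w : beta x w -> Y w -> f w <> f (p i).
    move=> xw [Aw nN] fwi; apply: nN; split=> //; exists i; split=> //.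
    by apply: fR => //; split=> //; apply: pA.
  (* The label of [p i] does not occur on the part of the bag in [Y], so it can replace [k], leaving
     only labels below [k]. *)
  exists (fun w => if f w == k then f (p i) else f w); split.
    move=> w [xw Yw].
    have := fk w (conj xw (YA _ Yw)); have := fk (p i) (conj xi (pA i iN)).
    by have := fne w xw Yw; case: eqP; lia.
  move=> a b [xa Ya] [xb Yb] fab.
  apply: fR; [by split=> //; apply: YA..|].
  have := fne a xa Ya; have := fne b xb Yb.
  by move: fab; case: eqP => [->|_]; case: eqP => [->|_] //; congruence.
set D := colour_diam k in c'good *.
(* Segments of length [D + 4]: equally coloured vertices of [N] joined by a
   walk of length at most [D + 2] project to the same segment, so a
   monochromatic component meets [N] in at most one segment. *)
pose M := D + 4.
have /choice[proj projP] : forall v, exists i, N v -> near v i.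
  move=> v; have [[Av [i vi]]|nN] := pselect (N v); first by exists i.
  by exists 0.
pose c v := if pselect (N v) then odd (proj v %/ M) else c' v.
have cY v : ~ N v -> c v = c' v by rewrite /c; case: pselect.
have cN v : N v -> c v = odd (proj v %/ M) by rewrite /c; case: pselect.
exists c.
pose RA := induced A R.
have RAsym : forall a b, RA a b -> RA b a by apply: induced_sym.
have to_p v : N v -> exists2 m, m <= 1 & walk RA m v (p (proj v)).
  move=> Nv; have [iN [vp|vp]] := projP v Nv; first by exists 0.
  exists 1 => //; apply: walk1; split=> //; [by case: Nv|exact: pA].
(* Each projection costs at most one step, so a walk of length at most [D.+2] moves [proj] by at
   most [D + 4], the segment length [M]. *)
have proj_lip a b m : N a -> N b -> walk RA m a b -> proj b <= proj a + m.+2.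
  move=> Na Nb ab; have [m1 m1le ap] := to_p a Na; have [m2 m2le bp] := to_p b Nb.
  have [aN _] := projP a Na; have [bN _] := projP b Nb.
  have := geodesic pR nmin aN bN
    (walk_cat (walk_sym RAsym ap) (walk_cat ab bp)); lia.
have same_seg a b m : N a -> N b -> m <= D.+2 -> c a = c b -> walk RA m a b ->
    proj a %/ M = proj b %/ M.
  move=> Na Nb mD; rewrite !cN // => cab ab.
  have := proj_lip a b m Na Nb ab.
  have := proj_lip b a m Nb Na (walk_sym RAsym ab).
  move=> ba ab'; apply: eq_divn_odd cab _ _; rewrite /M; lia.
pose monoY := linked (same_colour c' (induced Y R)).
have monoY_walk a b : monoY a b -> exists2 m, m <= D & walk RA m a b.
  move=> /c'good[m mD ab]; exists m => //; apply: walk_sub ab => x y [Yx Yy xy].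
  by split=> //; apply: YA.
pose mono := same_colour c RA.
(* Here [t] is the first vertex of [N] on the walk. Between consecutive visits to [N] the walk stays
   in one component of [c'] on [Y], so a shortcut of length at most [D + 2] joins them and
   [same_seg] carries the segment of [b] back to [t]. *)
have to_N a b : N b -> linked mono a b -> exists t,
    [/\ N t, proj t %/ M = proj b %/ M, c t = c b, c a = c t & a = t \/
    exists y, [/\ Y a, Y y, RA y t & monoY a y]].
  move=> Nb [l]; elim: l a => [|l IHl] a /=.
    by move=> ->; exists b; split=> //; left.
  case=> a' [aa' caa'] /IHl[t [Nt qt ct ca't ht]].
  have [Aa Aa' Raa'] := aa'.
  have [Na|nNa] := pselect (N a).
    exists a; split=> //; [rewrite -qt|by rewrite caa' ca't|by left].
    case: ht => [a't|[y [Ya' Yy yt a'y]]].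
      by apply: (@same_seg a t 1) => //; [rewrite caa'|rewrite -a't; apply: walk1].
    have [m mD a'yw] := monoY_walk _ _ a'y.
    apply: (@same_seg a t (1 + (m + 1))) => //; [by lia|by rewrite caa'|].
    exact: walk_cat (walk1 aa') (walk_cat a'yw (walk1 yt)).
  exists t; split=> //; [by rewrite caa'|right].
  case: ht => [a't|[y [Ya' Yy yt a'y]]].
    exists a; split=> //; [by rewrite -a't|exact: linked_refl].
  exists y; split=> //.
  apply: linked_trans a'y; exists 1; apply: walk1; split.
    by split=> //; apply: NY.
  by rewrite -!cY //; case: Ya'.
have mono_sym a b : mono a b -> mono b a by exact: same_colour_sym.
(* Either [c'] already bounds the distance, or some vertex of [N] serves as a common target for
   [to_N] from both ends. *)
have dichotomy a b : A a -> linked mono a b -> monoY a b \/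
    exists t, [/\ N t, linked mono a t & linked mono b t].
  move=> Aa [l]; elim: l a Aa => [|l IHl] a Aa /=.
    by move=> ->; left; apply: linked_refl.
  case=> w aw wb; have [[_ Aw Raw] caw] := aw.
  have aw1 : linked mono a w by exists 1; apply: walk1.
  have ab : linked mono a b by apply: linked_trans aw1 _; exists l.
  have [Na|nNa] := pselect (N a).
    by right; exists a; split; [|exact: linked_refl|exact: linked_sym].
  have [Nw|nNw] := pselect (N w).
    by right; exists w; split=> //; apply: linked_sym => //; exists l.
  case: (IHl w Aw wb) => [wbY|[t [Nt wt bt]]].
    left; apply: linked_trans wbY; exists 1; apply: walk1; split.
      by split=> //; apply: NY.
    by rewrite -!cY.
  by right; exists t; split=> //; apply: linked_trans wt.
move=> u v uv.
have [Au|nAu] := pselect (A u); last first.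
  case: uv => -[|l]; first by move=> /= ->; exists 0.
  by case=> w [[]].
have [uvY|[b [Nb ub vb]]] := dichotomy u v Au uv.
  by have [m mD uvw] := monoY_walk _ _ uvY; exists m => //=; lia.
have near_N a t : a = t \/ (exists y, [/\ Y a, Y y, RA y t & monoY a y]) ->
    exists2 m, m <= D.+1 & walk RA m a t.
  case=> [->|[y [_ _ yt /monoY_walk[m mD ay]]]]; first by exists 0.
  by exists (m + 1); [lia|apply: walk_cat ay (walk1 yt)].
have [t1 [Nt1 q1 _ _ /near_N[m1 m1D w1]]] := to_N u b Nb ub.
have [t2 [Nt2 q2 _ _ /near_N[m2 m2D w2]]] := to_N v b Nb vb.
have [m3 m3le w3] := to_p t1 Nt1; have [m4 m4le w4] := to_p t2 Nt2.
have [m5 m5M w5] : exists2 m, m <= M & walk RA m (p (proj t1)) (p (proj t2)).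
  have [i1 _] := projP t1 Nt1; have [i2 _] := projP t2 Nt2.
  have M0 : 0 < M by rewrite /M; lia.
  have := divn_eq (proj t1) M; have := divn_eq (proj t2) M.
  have := ltn_pmod (proj t1) M0; have := ltn_pmod (proj t2) M0.
  rewrite q1 q2 => r2 r1 e2 e1.
  have [le|/ltnW le] := leqP (proj t1) (proj t2).
    exists (proj t2 - proj t1); first by lia.
    by apply: walk_fun => // l ll; apply: pR; lia.
  exists (proj t1 - proj t2); first by lia.
  by apply: walk_sym => //; apply: walk_fun => // l ll; apply: pR; lia.
exists (m1 + m3 + m5 + (m4 + m2)).
  by move: m5M; rewrite /= -/D /M; lia.
apply: walk_cat (walk_cat (walk_cat w1 w3) w5) _.
exact: walk_cat (walk_sym RAsym w4) (walk_sym RAsym w2).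
Qed.

End Connected.

(** Induct on [k], colouring each connected component of [A] separately. Without labels [A] is
    empty. *)
Lemma finite_colouring k (A : set V) (s : seq V) :
  (A `<=` listed s)%classic ->
  (forall x, clique_cover R k (beta x `&` A)%classic) ->
  exists c, good_colouring (induced A R) (colour_diam k) c.
Proof.
elim: k A => [|k IH] A As cov.
  exists (fun=> true) => u v [[|n] /=]; first by move=> ->; exists 0.
  case=> w [[Au _ _] _] _; have [x xu] := vertex_bag u.
  by have [f [/(_ u (conj xu Au))]] := cov x.
pose comp a : set V := fun v => A v /\ linked (induced A R) a v.
have compA a : (comp a `<=` A)%classic by move=> v [].
have comp_eq a v : linked (induced A R) a v -> comp a = comp v.
  move=> av; have va := linked_sym (@induced_sym A) av.
  by apply/predeqP => w; split=> -[Aw lw]; split=> //; apply: linked_trans lw.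
have stays a n u v : comp a u -> walk (induced A R) n u v ->
    walk (induced (comp a) R) n u v.
  elim: n u => [|n IHn] u //= [Au au] [w uw wv]; have [_ Aw Ruw] := uw.
  have cw : comp a w by split=> //; apply: linked_trans au _; exists 1; apply: walk1.
  by exists w; [split|apply: IHn].
(* The colouring is chosen per set and not per vertex, so that all vertices of a component use the
   same one. *)
have /choice[C Cgood] : forall S : set V, exists c, (exists a, S = comp a) ->
    good_colouring (induced S R) (colour_diam k.+1) c.
  move=> S; have [[a ->]|nS] := pselect (exists a, S = comp a); last first.
    by exists (fun=> true).
  have [||||c cgood] := @connected_colouring (comp a) s k.
  - by move=> v /compA/As.
  - move=> u v [Au au] [Av av].
    have [n uv] := linked_trans (linked_sym (@induced_sym A) au) av.
    by exists n; apply: stays.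
  - move=> x; have [f [fk fR]] := cov x.
    exists f; split=> [v [xv /compA Av]|u v [xu /compA Au] [xv /compA Av]].
      exact: fk.
    exact: fR.
  - by move=> B BS; apply: IH => v /BS/compA/As.
  by exists c.
exists (fun v => C (comp v) v) => u v [n uv].
have [Au|nAu] := pselect (A u); last first.
  by case: n uv => [/= ->|n [w [[]]]] //; exists 0.
have transfer n' w : comp u w ->
    walk (same_colour (fun v => C (comp v) v) (induced A R)) n' w v ->
    walk (same_colour (C (comp u)) (induced (comp u) R)) n' w v.
  elim: n' w => [|n' IHn] w //= cw [w' [ww' cww'] w'v]; have [_ Aw' Rww'] := ww'.
  have cw' : comp u w'.
    by split=> //; apply: linked_trans cw.2 _; exists 1; apply: walk1.
  exists w'; last exact: IHn.
  by split=> //; rewrite (comp_eq _ _ cw.2) cww' -(comp_eq _ _ cw'.2) (comp_eq _ _ cw.2).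
have [|m mD uv'] := Cgood (comp u) (ex_intro _ u erefl) u v.
  by exists n; apply: transfer uv; split=> //; apply: linked_refl.
exists m => //; apply: walk_sub uv' => a b [/compA Aa /compA Ab ab]; by split.
Qed.

(* Compactness: a limit along an ultrafilter of the colourings of finite sets. *)
Theorem bounded_colouring k : (forall x, clique_cover R k (beta x)) ->
  exists c, good_colouring R (colour_diam k) c.
Proof.
move=> cov.
have /choice[C Cgood] : forall s : seq V, exists c,
    good_colouring (induced (listed s) R) (colour_diam k) c.
  move=> s; apply: (@finite_colouring _ _ s) => // x.
  by have [f [fk fR]] := cov x; exists f; split=> [v []|u v [xu _] [xv _]]; auto.
(* Generated by the cones of all lists that contain a given one, so a finer ultrafilter contains
   every such cone. *)
pose F : set_system (seq V) := fun X => exists s, forall s',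
  (listed s `<=` listed s')%classic -> X s'.
have FF : ProperFilter F.
  split; first by case=> s /(_ s); apply.
  split=> [|X Y [s sX] [t tY]|X Y XY [s sX]]; first by exists [::].
    exists (s ++ t) => s' st; split.
      by apply: sX => v sv; apply/st/List.in_or_app; left.
    by apply: tY => v sv; apply/st/List.in_or_app; right.
  by exists s => s' /sX/XY.
have [U [UU FU]] := ultraFilterLemma FF.
pose c v := `[< U [set s | C s v = true]%classic >].
have agree v : U [set s | C s v = c v]%classic.
  rewrite /c; have [Uv|nUv] := asboolP (U _); first exact: Uv.
  have [//|] := in_ultra_setVsetC [set s | C s v = true]%classic UU.
  by apply: filterS => s /= /negP/negbTE.
have agree_seq s : U [set s' | forall v, List.In v s -> C s' v = c v]%classic.
  elim: s => [|a s IHs]; first by apply: filterS filterT => s' _ v [].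
  by apply: filterS (filterI (agree a) IHs) => s' [/= aE sE] v [<-|/sE].
exists c => u v [n uv0]; have [s uv] := walk_support uv0.
have Us : U [set s' | (listed s `<=` listed s')%classic]%classic.
  by apply: FU; exists s.
(* A single list that contains the walk and whose colouring agrees with the limit [c] along it. *)
have [s' [/= ss' cs']] := filter_ex (filterI Us (agree_seq s)).
have [|m mD uv'] := Cgood s' u v.
  exists n; apply: walk_sub uv => a b [sa sb [ab cab]].
  by split; [split; auto|rewrite !cs'].
by exists m => //; apply: walk_sub uv' => a b [].
Qed.

End Colouring.

(** * The graph of monochromatic components *)

Section Quotient.
Variables (V : Type) (R : V -> V -> Prop).
Hypothesis Rsym : forall u v, R u v -> R v u.
Variables (c : V -> bool).

Local Notation mono := (same_colour c R).

Lemma mono_sym u v : mono u v -> mono v u.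
Proof. by case=> /Rsym vu cuv; split. Qed.

(** Components are vertex sets, so that two with a common vertex are equal and not merely
    equivalent. *)
Definition component : Type := {S : set V | exists v, S = linked mono v}.

Definition component_of v : component :=
  exist _ (linked mono v) (ex_intro _ v erefl).

Lemma component_ofE (S : component) v : sval S v -> S = component_of v.
Proof.
case: S => S [a Sa] /= av; apply: eq_exist; rewrite Sa in av *.
apply/predeqP => w; split; first exact: linked_trans (linked_sym mono_sym av).
exact: linked_trans av.
Qed.

Definition component_adj (S T : component) :=
  S <> T /\ exists a b, [/\ sval S a, sval T b & R a b].

Lemma component_adj_sym S T : component_adj S T -> component_adj T S.
Proof.
by case=> ne [a [b [Sa Tb /Rsym ba]]]; split; [apply: nesym|exists b, a].
Qed.

Lemma component_adj_irrefl S : ~ component_adj S S.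
Proof. by case. Qed.

Definition component_graph : graph :=
  Graph component_adj_sym component_adj_irrefl.

Lemma walk_component n u v : walk R n u v -> exists2 m, m <= n &
  walk component_adj m (component_of u) (component_of v).
Proof.
move=> uv; rewrite -[n]mul1n.
apply: walk_stretch uv => a b ab.
have [->|ne] := pselect (component_of a = component_of b); first by exists 0.
exists 1 => //; apply: walk1; split=> //.
by exists a, b; split=> //; apply: linked_refl.
Qed.

(** The walk visits [n + 1] components: crossing each costs at most [D], and each of the [n] edges
    costs 1. *)
Lemma walk_of_component D n u v : good_colouring R D c ->
  walk component_adj n (component_of u) (component_of v) ->
  exists2 m, m <= n * D.+1 + D & walk R m u v.
Proof.
move=> cgood; elim: n u => [|n IH] u /=.
  move=> uv; have: sval (component_of u) v by rewrite uv; apply: linked_refl.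
  by move=> /cgood[m mD w]; exists m.
case=> S [_ [a [b [/= /cgood[m mD ua] Sb ab]]]].
rewrite (component_ofE Sb) => /IH[m' m'D bv].
exists (m + (1 + m')); first by lia.
exact: walk_cat ua (walk_cat (walk1 ab) bv).
Qed.

Variables (disp : Order.disp_t) (L : orderType disp) (beta : L -> set V).
Hypothesis cb : convex_bags beta.
Hypothesis edge_bag : forall u v, R u v -> shares_bag beta u v.
Hypothesis vertex_bag : forall v, exists x, beta x v.

Definition component_bag x : set component_graph :=
  fun S => exists2 a, beta x a & sval S a.

(** A component is connected, so [walk_meets_bag] shows that it meets every bag between two that it
    meets. *)
Lemma component_line_decomposition : line_decomposition component_bag.
Proof.
split.
- move=> S T [_ [a [b [Sa Tb /edge_bag[x [xa xb]]]]]].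
  by exists x; split; [exists a|exists b].
- case=> S [a Sa]; have [x xa] := vertex_bag a.
  by exists x, a => //=; rewrite Sa; apply: linked_refl.
- move=> S x y z xy yz [a xa Sa] [b zb Sb].
  have [n /walkP[p [p0 pn pR]]] : linked mono a b.
    by move: Sb; rewrite (component_ofE Sa).
  have [|||||i iN yi] := @walk_meets_bag _ _ _ beta cb n p x y z.
  - by move=> i /pR[/edge_bag].
  - exact: ltW.
  - exact: ltW.
  - by rewrite p0.
  - by rewrite pn.
  exists (p i) => //; rewrite (component_ofE Sa) /= -p0; exists (i - 0).
  by apply: walk_fun => // l ll; apply: pR; lia.
Qed.

(** Equally coloured vertices of one clique lie in one component, so the clique label and the
    colour, coded as [f a + c a * k], determine the component. *)
Lemma card_component_bag k x : clique_cover R k (beta x) ->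
  (component_bag x #<= `I_(2 * k))%card.
Proof.
move=> [f [fk fR]].
have /choice[g gP] : forall S : component, exists m, component_bag x S ->
    exists a, [/\ beta x a, sval S a & m = f a + c a * k].
  move=> S; have [[a xa Sa]|nS] := pselect (component_bag x S); last by exists 0.
  by exists (f a + c a * k) => _; exists a.
apply/pcard_leP/injfunPex; exists g.
  move=> S xS; have [a [xa _ ->]] := gP S xS.
  by have := fk a xa; rewrite /=; case: (c a); lia.
move=> S T /set_mem xS /set_mem xT.
have [a [xa Sa ->]] := gP S xS; have [b [xb Tb ->]] := gP T xT => eab.
have [fab cab] : f a = f b /\ c a = c b.
  by move: eab (fk a xa) (fk b xb); case: (c a); case: (c b); lia.
rewrite (component_ofE Sa) (component_ofE Tb).
have [->//|ab] := fR a b xa xb fab.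
by apply: component_ofE; exists 1; apply: walk1.
Qed.

End Quotient.

(** * Distances and quasi-isometries *)

Section Distances.
Local Open Scope ereal_scope.

Lemma least_leP P n : least P <= n%:R%:E <-> exists2 m, (m <= n)%N & P m.
Proof.
rewrite /least; case: pselect => [ex|nex].
  case: ex_minnP => m /asboolP Pm mmin; rewrite lee_fin ler_nat.
  split=> [mn|[l ln Pl]]; first by exists m.
  by apply: leq_trans ln; apply: mmin; apply/asboolP.
rewrite leye_eq; split=> // -[m _ Pm]; case: nex; exists m; exact/asboolP.
Qed.

Lemma leastP P : least P = +oo \/ exists2 n, P n & least P = n%:R%:E.
Proof.
rewrite /least; case: pselect => [ex|]; last by left.
by right; case: ex_minnP => m /asboolP Pm _; exists m.
Qed.

Variables (G : graph).

Lemma path_walk (u v : G) n : is_path u v n -> walk (@adj G) n u v.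
Proof. by case=> p [p0 pn _ pR]; apply/walkP; exists p. Qed.

(** A shortest walk repeats no vertex, by [geodesic] applied to walks of length 0, so it is a
    path. *)
Lemma dist_leP (u v : G) n :
  dist u v <= n%:R%:E <-> exists2 m, (m <= n)%N & walk (@adj G) m u v.
Proof.
rewrite least_leP; split=> -[m mn].
  by move=> /path_walk; exists m.
move=> uv; have [l luv lmin] := shortest_walk (ex_intro _ m uv).
exists l; first by apply: leq_trans mn; apply: lmin.
have [p [p0 pl pR]] := (walkP _ _ _ _).1 luv.
exists p; split=> // i j il jl pij.
have geo := geodesic pR _; rewrite p0 pl in geo.
have := geo lmin i j 0%N il jl pij; have := geo lmin j i 0%N jl il (esym pij); lia.
Qed.

Lemma distP (u v : G) : dist u v = +oo \/
  exists2 n, walk (@adj G) n u v & dist u v = n%:R%:E.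
Proof.
by have [|[n /path_walk]] := leastP (is_path u v); [left|right; exists n].
Qed.

End Distances.

Section QuasiIsometries.
Local Open Scope ereal_scope.
Variables (G H : graph) (phi : G -> H) (q : nat).
Hypothesis q0 : (0 < q)%N.

(** The second premise is the lower bound multiplied out by [q]; infinite distances become the
    absence of walks. *)
Lemma quasi_isometry_of_walks :
  (forall u v n, walk (@adj G) n u v ->
    exists2 m, (m <= q * n + q)%N & walk (@adj H) m (phi u) (phi v)) ->
  (forall u v n, walk (@adj H) n (phi u) (phi v) ->
    exists2 m, (m <= q * (n + q))%N & walk (@adj G) m u v) ->
  (forall x, exists v, x = phi v) -> quasi_isometry q phi.
Proof.
move=> up low surj; split; last first.
  by move=> x; have [v ->] := surj x; exists v; apply/dist_leP; exists 0%N.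
have qQ : (0 < q%:R :> rat)%R by rewrite ltr0n.
move=> u v; split.
  have [->|[n /low/dist_leP d ->]] := distP (phi u) (phi v); first exact: leey.
  have [duv|[m _ duv]] := distP u v; first by move: d; rewrite duv leye_eq.
  move: d; rewrite duv -EFinM -EFinB !lee_fin => d.
  rewrite lerBlDr ler_pdivrMl // -natrD -natrM; exact: d.
have [->|[n /up/dist_leP d ->]] := distP u v.
  by rewrite mulry gtr0_sg // mul1e addye // leey.
by rewrite -EFinM -EFinD -natrM -natrD.
Qed.

Lemma quasi_isometry_walk u v n : quasi_isometry q phi ->
  walk (@adj G) n u v ->
  exists2 m, (m <= q * n + q)%N & walk (@adj H) m (phi u) (phi v).
Proof.
move=> [/(_ u v)[_ up] _] uv; apply/dist_leP; apply: le_trans up _.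
rewrite natrD natrM EFinD EFinM leeD2r // lee_pmul2l ?lte_fin ?ltr0n //.
by apply/dist_leP; exists n.
Qed.

Lemma quasi_isometry_walk_inv u v n : quasi_isometry q phi ->
  walk (@adj H) n (phi u) (phi v) ->
  exists2 m, (m <= q * (n + q))%N & walk (@adj G) m u v.
Proof.
move=> [/(_ u v)[low _] _] uv; apply/dist_leP.
have {low}: (q%:R^-1)%:E * dist u v - q%:R%:E <= n%:R%:E.
  by apply: le_trans low _; apply/dist_leP; exists n.
have qQ : (0 < q%:R :> rat)%R by rewrite ltr0n.
have [->|[m _ ->]] := distP u v.
  by rewrite mulry gtr0_sg ?invr_gt0 // mul1e addye.
rewrite -EFinM -EFinB !lee_fin lerBlDr ler_pdivrMl //.
by rewrite -natrD -natrM.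
Qed.

End QuasiIsometries.

(** * Linewidth and centred decompositions *)

Lemma sub_one_le (x : \bar rat) n :
  (x - 1 <= n%:R%:E - 1)%E = (x <= n%:R%:E)%E.
Proof. by rewrite leeBlDr // subeK. Qed.

Lemma width_leP (G : graph) (disp : Order.disp_t) (L : orderType disp)
    (beta : L -> set G) n :
  (width beta <= n%:R%:E - 1)%E <-> forall x, (beta x #<= `I_n)%card.
Proof.
rewrite /width sub_one_le least_leP; split=> [[m mn bm] x|bn]; last by exists n.
by apply: card_le_trans (bm x) _; rewrite card_le_II.
Qed.

Lemma linewidth_leP (G : graph) n : (linewidth G <= n%:R%:E - 1)%E <->
  exists (disp : Order.disp_t) (L : orderType disp) (beta : L -> set G),
    line_decomposition beta /\ forall x, (beta x #<= `I_n)%card.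
Proof.
rewrite /linewidth sub_one_le least_leP.
split=> [[m mn [disp [L [beta [ld /width_leP bm]]]]]|[disp [L [beta [ld bn]]]]].
  exists disp, L, beta; split=> // x.
  by apply: card_le_trans (bm x) _; rewrite card_le_II.
by exists n => //; exists disp, L, beta; split=> //; apply/width_leP.
Qed.

Lemma centred_clique_cover k d (G : graph) (S : set G) : centred k d S ->
  exists f : G -> nat, (forall v, S v -> f v < k) /\
    forall u v, S u -> S v -> f u = f v ->
      exists2 m, m <= d & walk (@adj G) m u v.
Proof.
move=> [P [[cov _ _] /pcard_leP/injfunPex[g gk ginj] diam]].
have /choice[X XP] : forall v, exists X : set G, S v -> P X /\ X v.
  move=> v; have [Sv|nS] := pselect (S v); last by exists set0.
  have [X PX Xv] : cover P id v by rewrite cov.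
  by exists X.
exists (fun v => g (X v)); split=> [v /XP[PX _]|u v Su Sv eg].
  exact: gk.
have [PXu Xu] := XP u Su; have [PXv Xv] := XP v Sv.
have eX : X u = X v by apply: ginj => //; apply/mem_set.
have /least_leP[m md mX] := diam _ PXu.
have /dist_leP[l lm uv] := mX u v Xu (eq_ind_r (fun Y => Y v) Xv eX).
by exists l => //; apply: leq_trans lm md.
Qed.

(** Keeping both lengths lets either half of the walk witness closeness to its end. *)
Lemma line_decomposition_walk_meets_bag (G : graph) (disp : Order.disp_t)
    (L : orderType disp) (beta : L -> set G) n (u v : G) x y z :
  line_decomposition beta -> (x < y)%O -> (y < z)%O ->
  beta x u -> beta z v -> walk (@adj G) n u v ->
  exists w i, [/\ i <= n, walk (@adj G) i u w, walk (@adj G) (n - i) w v & beta y w].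
Proof.
move=> [eb _ cb] xy yz xu zv /walkP[p [p0 pn pR]].
have [|||||i iN yi] := @walk_meets_bag _ _ _ beta cb n p x y z.
- by move=> i /pR/eb.
- exact: ltW.
- exact: ltW.
- by rewrite p0.
- by rewrite pn.
exists (p i), i; split=> //.
  rewrite -p0 -{1}[i]subn0.
  by apply: walk_fun => // l ll; apply: pR; lia.
by rewrite -pn; apply: walk_fun.
Qed.

(** * From centred decompositions to bounded linewidth *)

Lemma bounded_linewidth_of_centred k d (G : graph) : 0 < d ->
  has_centred_line_decomposition k d G -> exists H : graph,
    quasi_isometric (d * (colour_diam k).+1) G H /\
    (linewidth H <= (2 * k)%:R%:E - 1)%E.
Proof.
move=> d0 [disp [L [beta [[eb vb cb] cent]]]].
(* Demanding a common bag keeps [beta] a decomposition for [R]; edges of [G] belong to [R] because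
   [d] is positive. *)
pose R (u v : G) :=
  (exists2 m, m <= d & walk (@adj G) m u v) /\ shares_bag beta u v.
have Rsym u v : R u v -> R v u.
  move=> [[m md uv] [x [xu xv]]]; split; last by exists x.
  by exists m => //; apply: walk_sym uv; apply: adj_sym.
have Rbag u v : R u v -> shares_bag beta u v by case.
have cover x : clique_cover R k (beta x).
  have [f [fk fd]] := centred_clique_cover (cent x); exists f; split=> // u v xu xv.
  by move=> /fd duv; right; split; [apply: duv|exists x].
have [c cgood] := bounded_colouring Rsym cb Rbag vb cover.
exists (component_graph Rsym c); split; last first.
  apply/linewidth_leP.
  exists disp, L, (@component_bag _ _ Rsym c _ _ beta); split.
    exact: component_line_decomposition.
  by move=> x; apply: card_component_bag.
(* With [D = colour_diam k] and [q = d * D.+1]: contraction does not lengthen walks, and backwards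
   [n * D.+1 + D] steps of [R], each of length at most [d], give at most [q * (n + 1)]. *)
exists (component_of R c); apply: quasi_isometry_of_walks.
- by rewrite muln_gt0 d0.
- move=> u v n uv; have [|m mn w] := @walk_component _ R c n u v.
    apply: walk_sub uv => a b ab; split; last exact: eb.
    by exists 1 => //; apply: walk1.
  by exists m => //; nia.
- move=> u v n /(walk_of_component Rsym cgood)[m mn uv].
  have [|l lm w] := @walk_stretch _ _ R (@adj G) id d m u v _ uv.
    by move=> a b [].
  by exists l => //; set D := colour_diam k in mn *; nia.
- by move=> S; case: (S) => T [v Tv]; exists v; apply: (component_ofE Rsym) => /=;
    rewrite Tv; apply: linked_refl.
Qed.

(** * From bounded linewidth to centred decompositions *)

Lemma centred_of_bounded_linewidth c k (G H : graph) (phi : G -> H) : 0 < c ->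
  quasi_isometry c phi -> (linewidth H <= k%:R%:E - 1)%E ->
  has_centred_line_decomposition k (3 * c ^ 2) G.
Proof.
move=> c0 qi /linewidth_leP[disp [L [beta [ld bk]]]]; have [eb vb cb] := ld.
pose near v w := exists2 m, m <= c & walk (@adj H) m (phi v) w.
have adjH_sym := @adj_sym H.
exists disp, L, (fun x v => exists2 w, beta x w & near v w); split; first split.
- move=> u v uv; have [m mc w] := quasi_isometry_walk c0 qi (walk1 uv).
  have [y uy yv] : exists2 y, near u y & near v y.
    (* Since [m <= 2 * c], cutting after [minn m c] steps leaves at most [c]. *)
    have e : m = minn m c + (m - c) by lia.
    rewrite e in w; have [y uy yv] := walk_split w; exists y.
      by exists (minn m c) => //; lia.
    by exists (m - c); [lia|exact: walk_sym].
  by have [x xy] := vb y; exists x; split; exists y.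
- move=> v; have [x xv] := vb (phi v).
  by exists x, (phi v) => //; exists 0.
- move=> v x y z xy yz [a xa [m mc va]] [b zb [l lc vb']].
  (* A bag of [phi v] itself lies on one side of [y] or at [y]. The short walk from [phi v] to a
     vertex on the other side crosses [beta y] without leaving the ball of radius [c]. *)
  have [t0 t0v] := vb (phi v).
  have [ty|yt|ty] := ltgtP t0 y.
  + have [w [i [il vw _ yw]]] :=
      line_decomposition_walk_meets_bag ld ty yz t0v zb vb'.
    by exists w => //; exists i => //; lia.
  + have [w [i [im _ wv yw]]] := line_decomposition_walk_meets_bag ld xy yt xa t0v
      (walk_sym adjH_sym va).
    by exists w => //; exists (m - i); [lia|exact: walk_sym].
  + by exists (phi v); [rewrite -ty|exists 0].
- move=> x; set S := (S in centred _ _ S).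
  have [g gk ginj] := (injfunPex).1 (elimT pcard_leP (bk x)).
  (* The parts are the fibres of a choice of nearby bag vertex, so there are at most as many as bag
     vertices. *)
  have /choice[h hP] : forall v, exists w, S v -> beta x w /\ near v w.
    move=> v; have [[w xw vw]|nS] := pselect (S v); last by exists (phi v).
    by exists w.
  pose part v : set G := fun u => S u /\ h u = h v.
  exists (fun X => exists2 v, S v & X = part v); split.
  + split.
    * apply/predeqP => u; split=> [[X [v _ ->] []//]|Su].
      by exists (part u) => //; exists u.
    * move=> X Y [u _ ->] [v _ ->] [w [[_ wu] [_ wv]]].
      by apply/predeqP => a; rewrite /part -wu -wv.
    * by move=> X [v Sv ->]; exists v.
  + have /choice[f fP] : forall X : set G, exists n, (exists2 v, S v & X = part v) ->
        exists v, [/\ S v, X = part v & n = g (h v)].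
      move=> X; have [[v Sv Xv]|nX] := pselect (exists2 v, S v & X = part v).
        by exists (g (h v)) => _; exists v.
      by exists 0.
    apply/pcard_leP/injfunPex; exists f.
      by move=> X /fP[v [/hP[xv _] _ ->]]; apply: gk.
    move=> X Y /set_mem/fP[u [Su -> ->]] /set_mem/fP[v [Sv -> ->]] guv.
    have -> // : part u = part v.
    rewrite /part (_ : h u = h v) //.
    by apply: ginj => //; apply/mem_set; [have [] := hP u Su|have [] := hP v Sv].
  + move=> X [v Sv ->]; apply/least_leP; exists (3 * c ^ 2) => //.
    move=> a b [Sa ha] [Sb hb]; apply/dist_leP.
    have [_ [i ic ai]] := hP a Sa; have [_ [j jc bj]] := hP b Sb.
    have ab : walk (@adj H) (i + j) (phi a) (phi b).
      by apply: walk_cat ai _; rewrite ha -hb; apply: walk_sym.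
    (* As [i + j <= 2 * c], the distance in [G] is at most [c * (2 * c + c)], that is
       [3 * c ^ 2]. *)
    have [m mle w] := quasi_isometry_walk_inv c0 qi ab.
    by exists m => //; nia.
Qed.

Theorem theorem3 :
  exists q : nat -> nat -> nat,
    forall c d k : nat, (0 < c)%N -> (0 < d)%N -> (0 < k)%N ->
      [/\ (0 < q k d)%N,
          forall G : graph, has_centred_line_decomposition k d G ->
            exists H : graph,
              quasi_isometric (q k d) G H /\
              (linewidth H <= ((2 * k)%:R - 1)%R%:E)%E &
          forall G : graph,
            (exists H : graph,
               quasi_isometric c G H /\ (linewidth H <= (k%:R)%R%:E)%E) ->
            has_centred_line_decomposition (k + 1) (3 * c ^ 2) G].
Proof.
exists (fun k d => d * (colour_diam k).+1) => c d k c0 d0 k0; split.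
- by rewrite muln_gt0 d0.
- by move=> G /(bounded_linewidth_of_centred d0)[H [[phi qi] lw]]; exists H;
    split; [exists phi|rewrite EFinB].
- move=> G [H [[phi qi] lw]]; apply: centred_of_bounded_linewidth c0 qi _.
  (* Width [k] means bags of [k + 1] vertices. *)
  by rewrite addn1 -natr1 EFinD addeK.
Qed.
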